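(* If $G$ is a biconvex bipartite graph, then $G^2$ is $C_5$-free and hence perfect.
   Context: All graphs are finite, undirected and simple. The square $G^2$ of a graph $G$ has the same vertex set as $G$, and two distinct vertices are adjacent in $G^2$ iff their distance in $G$ is at most two. A bipartite graph $G=(A,B,E)$ is biconvex bipartite if the vertices of $A$ and of $B$ have linear orderings $<_A'$ and $<_B$, respectively, such that for each $a\in A$ the neighbours of $a$ in $G$ appear consecutively with respect to $<_B$, and for each $b\in B$ the neighbours of $b$ in $G$ appear consecutively with respect to $<_A'$. A graph is $C_5$-free if it has no induced cycle of length five. A graph is perfect if every induced subgraph $H'$ satisfies $\chi(H')=\omega(H')$. *)

(* Defs.v *)
From mathcomp Require Import all_boot.

Set Implicit Arguments.
Unset Strict Implicit.
Unset Printing Implicit Defensive.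

Record sgraph := SGraph {
  vertex :> finType;
  edge : rel vertex;
  edge_sym : symmetric edge;
  edge_irr : irreflexive edge }.

Arguments edge {s}.
Arguments edge_sym : clear implicits.
Arguments edge_irr : clear implicits.

(* The vertices of the path are x :: p, so its length is size p. *)
Definition path_from_to (G : sgraph) (x y : G) (p : seq G) : bool :=
  [&& path edge x p, uniq (x :: p) & last x p == y].

(* The distance is the least length of a path (infinite if there is none);
   it is at most d iff some path has length at most d. *)
Definition dist_le (G : sgraph) (d : nat) (x y : G) : bool :=
  [exists k : 'I_d.+1, exists p : k.-tuple G, path_from_to x y p].

Lemma dist_le_sym (G : sgraph) (d : nat) : symmetric (@dist_le G d).
Proof.
suff imp x y : @dist_le G d x y -> dist_le d y x.
  by move=> x y; apply/idP/idP; apply: imp.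
case/existsP=> k /existsP[p /and3P[path_p uniq_p /eqP last_p]].
have size_q : size (rev (belast x p)) == k.
  by rewrite size_rev size_belast size_tuple.
apply/existsP; exists k; apply/existsP; exists (Tuple size_q) => /=.
apply/and3P; split => /=.
- rewrite -last_p rev_path (eq_path (e' := edge)) // => u v.
  exact: edge_sym.
- by rewrite -/(uniq (y :: _)) -rev_rcons -last_p -lastI rev_uniq.
- case: (tval p) last_p => [|z s] /=; first by move->.
  by rewrite rev_cons last_rcons.
Qed.

Section Square.
Variable G : sgraph.

Definition square_edge (x y : G) : bool := (x != y) && dist_le 2 x y.

Lemma square_edge_sym : symmetric square_edge.
Proof. by move=> x y; rewrite /square_edge eq_sym dist_le_sym. Qed.

Lemma square_edge_irr : irreflexive square_edge.
Proof. by move=> x; rewrite /square_edge eqxx. Qed.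

Definition square : sgraph := SGraph square_edge_sym square_edge_irr.

End Square.

Section Induced.
Variables (G : sgraph) (S : {set G}).

Definition induced_edge : rel {x : G | x \in S} := relpre val edge.

Lemma induced_edge_sym : symmetric induced_edge.
Proof. by move=> x y; apply: edge_sym. Qed.

Lemma induced_edge_irr : irreflexive induced_edge.
Proof. by move=> x; apply: edge_irr. Qed.

Definition induced : sgraph := SGraph induced_edge_sym induced_edge_irr.

End Induced.

Definition linear_order_on (T : finType) (A : {set T}) (le : rel T) : Prop :=
  [/\ {in A, reflexive le}, {in A &, antisymmetric le},
      {in A & &, transitive le} & {in A &, total le}].

Definition consecutive_in (T : finType) (A : {set T}) (le : rel T)
    (S : {set T}) : Prop :=
  {in A & &, forall x y z,
    x \in S -> z \in S -> le x y -> le y z -> y \in S}.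

Definition neighbours (G : sgraph) (x : G) : {set G} := [set y | edge x y].

Definition bipartition (G : sgraph) (A B : {set G}) : Prop :=
  [/\ A :|: B = setT, [disjoint A & B] &
      forall x y : G, edge x y ->
        (x \in A) && (y \in B) || (x \in B) && (y \in A)].

Definition biconvex_bipartite (G : sgraph) : Prop :=
  exists A B : {set G}, bipartition A B /\
  exists leA leB : rel G,
    [/\ linear_order_on A leA, linear_order_on B leB,
        {in A, forall a, consecutive_in B leB (neighbours a)} &
        {in B, forall b, consecutive_in A leA (neighbours b)}].

(* This is the cycle on n vertices only for n >= 3. *)
Definition cycle_edge (n : nat) (i j : 'I_n) : bool :=
  (j == i.+1 %% n :> nat) || (i == j.+1 %% n :> nat).

Definition has_induced_cycle (G : sgraph) (n : nat) : Prop :=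
  exists f : 'I_n -> G,
    injective f /\ forall i j, edge (f i) (f j) = cycle_edge i j.

Definition C5_free (G : sgraph) : Prop := ~ has_induced_cycle G 5.

Definition colorable (G : sgraph) (k : nat) : bool :=
  [exists c : {ffun G -> 'I_k},
    [forall x, forall y, edge x y ==> (c x != c y)]].

Lemma ex_colorable (G : sgraph) : exists k, colorable G k.
Proof.
exists #|G|; apply/existsP; exists [ffun x => enum_rank x].
apply/forallP=> x; apply/forallP=> y; apply/implyP=> xy; rewrite !ffunE.
apply: contraTneq xy => /enum_rank_inj ->.
by rewrite edge_irr.
Qed.

Definition chromatic_number (G : sgraph) : nat := ex_minn (ex_colorable G).

Definition clique (G : sgraph) (K : {set G}) : bool :=
  [forall x in K, forall y in K, (x != y) ==> edge x y].

Definition clique_number (G : sgraph) : nat :=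
  \max_(K : {set G} | clique K) #|K|.

Definition perfect (G : sgraph) : Prop :=
  forall S : {set G},
    chromatic_number (induced S) = clique_number (induced S).

(* Main.v *)
Require Import Defs.
From mathcomp Require Import all_boot.
From mathcomp Require Import zify.

Set Implicit Arguments.
Unset Strict Implicit.
Unset Printing Implicit Defensive.

(* Colour an induced subgraph S of the square vertex by vertex, where
   k bounds the cliques in S.  Let v be the vertex of S on side A whose
   neighbourhood in the B-order has the leftmost right end r, and colour S - v.
   The square neighbours of v form two cliques, KA (all adjacent to r in G) and
   KB.  Some colour i misses KA; let y in KB carry it.  Then v, the vertices of
   KB from y on and the members of KA adjacent to y form a clique, so some
   colour j misses it except possibly at v.  If j occurs on KA, at x say, then
   biconvexity keeps the (i,j)-Kempe component of x off KB, and swapping there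
   clears j from KA.  Now either j is free at v, or j occurs on KB to the left
   of y, and one repeats with y moved left.  Finally, C5 has clique number 2 and
   is not 2-colourable, so C5-freeness follows from perfection. *)

(** * Squares, colourings and Kempe swaps over a bare relation *)

Definition square_rel (T : finType) (e : rel T) : rel T :=
  fun x y => (x != y) && (e x y || [exists z, e x z && e z y]).

Definition proper_on (T : finType) (e : rel T) (S : {set T}) (c : T -> nat) :=
  {in S &, forall s t, e s t -> c s <> c t}.

(** Positions are numbers, not assumed distinct, so that they can be maximised, reversed by
    subtraction and used to bound an induction. *)
Definition convex_for (T : finType) (e : rel T) (X : pred T) (pos : T -> nat) :=
  forall x y1 y y2, X x -> ~~ X y -> e x y1 -> e x y2 ->
    pos y1 <= pos y <= pos y2 -> e x y.

Definition kempe_swap (T : finType) (W : pred T) (i j : nat) (c : T -> nat) :=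
  fun s => if W s then (if c s == i then j else if c s == j then i else c s)
           else c s.

(** By symmetry of [e], an edge with both ends coloured [i] or [j] lies wholly inside or wholly
    outside [W]. On other edges the swap is harmless, since it only exchanges [i] and [j]. *)
Lemma kempe_swap_proper (T : finType) (e : rel T) (S : {set T}) (c : T -> nat)
    (W : pred T) (i j : nat) :
  symmetric e -> proper_on e S c ->
  {in S &, forall s t, c s \in [:: i; j] -> c t \in [:: i; j] -> e s t ->
    W s -> W t} ->
  proper_on e S (kempe_swap W i j c).
Proof.
move=> e_sym c_proper W_closed s t sS tS st.
have ts : e t s by rewrite e_sym.
have := c_proper s t sS tS st.
have := W_closed s t sS tS; have := W_closed t s tS sS.
rewrite st ts /kempe_swap !inE.
case: (W s); case: (W t);
  case: (c s =P i); case: (c s =P j); case: (c t =P i); case: (c t =P j) => /=;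
  try (move=> *; lia); move=> _ _ _ _ H1 H2;
  by [have := H1 isT isT isT isT | have := H2 isT isT isT isT].
Qed.

Lemma missing_colour (T : finType) (K : {set T}) (c : T -> nat) (k : nat) :
  #|K| < k -> exists2 i, i < k & {in K, forall s, c s != i}.
Proof.
move=> Kk; case: (boolP [exists i : 'I_k, [forall s in K, c s != i]]).
  by case/existsP=> i /forall_inP ?; exists i.
rewrite negb_exists => /forallP no_i; suff: k <= #|K| by rewrite leqNgt Kk.
rewrite -[k in k <= _](size_iota 0) cardE -(size_map c).
apply: uniq_leq_size (iota_uniq 0 k) _ => i; rewrite mem_iota add0n => /= ik.
have := no_i (Ordinal ik); rewrite negb_forall => /existsP[s].
rewrite negb_imply negbK => /andP[sK /eqP /= <-].
by rewrite map_f // mem_enum.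
Qed.

(** * The vertex with leftmost right end *)

Section LeftmostVertex.
Variables (T : finType) (e : rel T) (A : pred T) (pB : T -> nat).
Hypothesis e_sym : symmetric e.
Hypothesis e_bip : forall x y, e x y -> A x = ~~ A y.
Hypothesis convB : convex_for e A pB.

Local Notation sq := (square_rel e).

Lemma square_rel_sym : symmetric sq.
Proof.
move=> x y; rewrite /square_rel eq_sym e_sym; congr (_ && (_ || _)).
by apply: eq_existsb => z; rewrite andbC ![e _ z]e_sym.
Qed.

Lemma square_rel_edge x y : e x y -> sq x y.
Proof.
move=> xy; rewrite /square_rel xy andbT; apply: contraTneq xy => <-.
by apply/negP=> /[dup] /e_bip; case: (A x).
Qed.

Lemma square_rel_mid z x y : x != y -> e x z -> e y z -> sq x y.
Proof.
move=> xy xz yz; rewrite /square_rel xy /=; apply/orP; right.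
by apply/existsP; exists z; rewrite xz e_sym.
Qed.

Lemma square_relP x y : sq x y ->
  e x y \/ [/\ A x = A y, ~~ e x y & exists2 z, e x z & e y z].
Proof.
case/andP=> xy; case: (boolP (e x y)) => [|nxy /= /existsP[z /andP[xz zy]]].
  by left.
right; split => //; last by exists z; rewrite // e_sym.
by rewrite (e_bip xz) (e_bip zy) negbK.
Qed.

Variables (S : {set T}) (v r : T).
Hypothesis (vA : A v) (vr : e v r).
Hypothesis r_max : forall b, e v b -> pB b <= pB r.
Hypothesis v_min : forall a b, a \in S -> A a -> e a b ->
  exists2 b', e a b' & pB r <= pB b'.

Let rB : ~~ A r. Proof. by rewrite -(e_bip vr). Qed.

(** The neighbourhood of [a] meets that of [v] at or before [r] and, by [v_min], reaches [r] or
    beyond; convexity puts [r] in it. *)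
Lemma square_rel_leftmost a : a \in S -> A a -> sq v a -> e a r.
Proof.
move=> aS aA /square_relP[/e_bip|[_ _ [b vb ab]]]; first by rewrite vA aA.
have [b' ab' rb'] := v_min aS aA ab.
by apply: (convB aA rB ab ab'); rewrite rb' r_max.
Qed.

(** A neighbour of [a] at or before [r] would likewise make [r] a common neighbour of [a] and
    [v]. *)
Lemma right_of_leftmost a b :
  a \in S -> A a -> a != v -> ~~ sq v a -> e a b -> pB r < pB b.
Proof.
move=> aS aA av nva ab; rewrite ltnNge; apply: contra nva => br.
have [b' ab' rb'] := v_min aS aA ab.
apply: (@square_rel_mid r) => //; first by rewrite eq_sym.
by apply: (convB aA rB ab ab'); rewrite br.
Qed.

(** * A Kempe component that avoids the neighbours of [v] *)

Section Kempe.
Variables (c : T -> nat) (x y : T).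
Hypothesis c_proper : proper_on sq (S :\ v) c.
Hypotheses (xS : x \in S) (xA : A x) (vx : sq v x).
Hypotheses (yS : y \in S) (vy : e v y) (nxy : ~~ e x y).
Hypothesis KA_colours : {in S, forall a, A a -> sq v a ->
  c a \in [:: c y; c x] -> a = x}.
Hypothesis KB_colours : {in S, forall b, e v b ->
  c b \in [:: c y; c x] -> pB b <= pB y}.

(* Explicit superset of the Kempe component of [x], closed under its edges: on
   side A, [x] aside, it lies before [x] and sees only what is right of [r]; on B it
   lies right of [r] and sees only vertices before [v].  [E] says that [x] has
   a neighbour right of [r] at distance more than two from [y]; only then can
   the component reach vertices of B all of whose neighbours come after [x]. *)
Lemma kempe_component_oriented (pA : T -> nat) :
    convex_for e (predC A) pA -> pA x <= pA v ->
  exists W : pred T, [/\ W x, forall b, ~~ A b -> W b -> pB r < pB b &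
    {in S :\ v &, forall s t, c s \in [:: c y; c x] -> c t \in [:: c y; c x] ->
      sq s t -> W s -> W t}].
Proof.
move=> convA xv.
have xr : e x r by apply: square_rel_leftmost.
have yB : ~~ A y by rewrite -(e_bip vy).
have convA' b q1 q q2 : e b q1 -> e b q2 -> A q1 -> A q ->
    pA q1 <= pA q <= pA q2 -> e b q.
  move=> b1 b2 q1A qA; apply: (convA b q1 q q2) => //=; last by rewrite qA.
  by rewrite (e_bip b1) q1A.
pose E := [exists b, [&& ~~ A b, pB r < pB b, e x b & ~~ sq y b]].
pose W s := if A s
  then (s == x) || (pA s < pA x) && [forall b, e s b ==> (pB r < pB b)]
  else [&& pB r < pB s, [forall q, e s q ==> (pA q < pA v)] &
        [exists q, e s q && (pA q <= pA x)] || E].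
exists W; split; first by rewrite /W xA eqxx.
  by move=> b /negbTE bB; rewrite /W bB => /and3P[].
have WAP s : A s -> W s -> s = x \/ pA s < pA x /\ forall b, e s b -> pB r < pB b.
  move=> sA; rewrite /W sA => /orP[/eqP|/andP[sx /forallP sr]]; [by left|right].
  by split=> // b sb; apply: implyP (sr b) sb.
have nv s : pB r < pB s -> ~~ e s v.
  by move=> rs; apply: contraL rs; rewrite e_sym -leqNgt => /r_max.
have left_all s q : pB r < pB s -> e s q -> pA q < pA v -> A q ->
    [forall q', e s q' ==> (pA q' < pA v)].
  move=> rs sq qv qA; apply/forallP=> q'; apply/implyP=> sq'.
  rewrite ltnNge; apply: contra (nv s rs) => vq'.
  by apply: (convA' s q v q') => //; rewrite vq' ltnW.
have WA_other p : p \in S :\ v -> A p -> c p \in [:: c y; c x] ->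
    p = x \/ forall b, e p b -> pB r < pB b.
  rewrite in_setD1 => /andP[pv pS] pA' cp; case: (boolP (sq v p)) => vp.
    by left; apply: KA_colours.
  by right=> b; apply: right_of_leftmost.
(* Both [x] and [v] are adjacent to [r], hence so is any vertex of side A between them; [p] must
   therefore come before [x]. *)
have WA_intro p : A p -> pA p < pA v -> (forall b, e p b -> pB r < pB b) -> W p.
  move=> pA' pv pr; rewrite /W pA'; apply/orP; right; apply/andP; split.
    rewrite ltnNge; apply/negP=> xp.
    have: e r p by apply: (convA' r x p v); rewrite ?(e_sym r) // xp ltnW.
    by rewrite e_sym => /pr; rewrite ltnn.
  by apply/forallP=> b; apply/implyP/pr.
move=> s t sS tS cs ct st Ws.
have cst := c_proper sS tS st.
have [sS0 tS0] : s \in S /\ t \in S by case/setD1P: sS; case/setD1P: tS.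
case: (boolP (A s)) => sA; case: (boolP (A t)) => tA.
(* If [t] came at or after [v], the common neighbour [b] would be adjacent to [v] although it is
   right of [r]. *)
- have [/e_bip|[_ _ [b sb tb]]] := square_relP st; first by rewrite sA tA.
  have [->|tr] := WA_other t tS tA ct; first by rewrite /W xA eqxx.
  apply: WA_intro => //; have rb := tr _ tb.
  rewrite ltnNge; apply: contra (nv b rb) => vt.
  apply: (convA' b s v t) => //; rewrite 1?e_sym // vt andbT.
  by have [->|[/ltnW sx _]] := WAP s sA Ws; rewrite ?xv // (leq_trans sx).
- have {}st : e s t by have [//|[]] := square_relP st; rewrite sA (negbTE tA).
  have sx : pA s <= pA x by have [->|[/ltnW]] := WAP s sA Ws.
  (* Only [s = x] needs an argument: a neighbour [t] of [x] up to [r] lies after [y], else [x] sees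
     [y]; so [t] is adjacent to [v], against [KB_colours]. *)
  have rt : pB r < pB t.
    have [sx0|[_ sr]] := WAP s sA Ws; last exact: sr.
    rewrite ltnNge; apply/negP=> tr; subst s.
    have yt : pB y < pB t.
      rewrite ltnNge; apply: contra nxy => ty.
      by apply: (convB xA yB st xr); rewrite ty r_max.
    have vt : e v t by apply: (convB vA tA vy vr); rewrite (ltnW yt).
    by have := KB_colours tS0 vt ct; rewrite leqNgt yt.
  rewrite /W (negbTE tA) rt (left_all t s) //=; last 2 first.
  + by rewrite e_sym.
  + rewrite ltn_neqAle (leq_trans sx xv) andbT; apply/eqP=> sv.
    have/negP[] := nv t rt; apply: (convA' t s v s); rewrite ?(e_sym t) //.
    by rewrite sv leqnn.
  by apply/orP; left; apply/existsP; exists s; rewrite e_sym st.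
- move: Ws; rewrite /W (negbTE sA) => /and3P[rs /forallP sv _].
  have {}st : e s t by have [//|[]] := square_relP st; rewrite (negbTE sA) tA.
  have tv : pA t < pA v by apply: implyP (sv t) st.
  rewrite -/(W t); have [->|tr] := WA_other t tS tA ct.
    by rewrite /W xA eqxx.
  exact: WA_intro.
move: (Ws); rewrite /W (negbTE sA) => /and3P[rs /forallP sv sxE].
have [/e_bip|[_ _ [w sw tw]]] := square_relP st.
  by rewrite (negbTE sA) (negbTE tA).
have wA : A w by rewrite (e_bip (_ : e w s)) ?sA // e_sym.
have wv : pA w < pA v by apply: implyP (sv w) sw.
have rs_x : [exists q, e s q && (pA q <= pA x)] -> pA x <= pA w -> e s x.
  case/existsP=> q /andP[sq' qx] xw.
  have qA : A q by rewrite (e_bip (_ : e q s)) ?sA // e_sym.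
  by apply: (convA' s q x w) => //; rewrite qx.
have sy_neq : s != y by apply: contraTneq rs => ->; rewrite -leqNgt r_max.
(* [s] has the colour of [x] or of [y], so it is not a square neighbour of both. *)
have s_near : e s x -> ~~ sq y s.
  move=> sx; apply/negP=> ys.
  have yS' : y \in S :\ v.
    by rewrite !inE yS andbT; apply: contraNneq yB => ->.
  have xS' : x \in S :\ v.
    by rewrite !inE xS andbT; case/andP: vx; rewrite eq_sym.
  have := c_proper yS' sS ys; have := c_proper sS xS' (square_rel_edge sx).
  by move: cs; rewrite !inE => /orP[] /eqP ->.
(* If [w] saw [y], then [w] would not precede [x], as [y] does not see [x], and [s] would be a
   square neighbour of [y], hence not adjacent to [x]. This excludes the first disjunct of [sxE]; a
   witness of [E] would lie between [y] and [s], where [w] joins it to [y]. *)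
have wy : ~~ e w y.
  apply/negP=> wy.
  have xw : pA x <= pA w.
    rewrite leqNgt; apply: contra nxy => wx; rewrite e_sym.
    apply: (convA' y w x v); rewrite ?(e_sym y) //.
    by rewrite xv ltnW.
  have ys_sq : sq y s.
    by apply: (@square_rel_mid w); rewrite 1?eq_sym // e_sym.
  case: (boolP (e s x)) => [/s_near|nsx]; first by rewrite ys_sq.
  case/orP: sxE => [/rs_x/(_ xw)|/existsP[b /and4P[bB rb xb /negP[]]]].
    by rewrite (negbTE nsx).
  have bs : pB b < pB s.
    rewrite ltnNge; apply: contra nsx => sb; rewrite e_sym.
    by apply: (convB xA sA xr xb); rewrite sb ltnW.
  apply: (@square_rel_mid w); first by apply: contraTneq rb => <-; rewrite -leqNgt r_max.
    by rewrite e_sym.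
  rewrite e_sym; apply: (convB wA bB wy (_ : e w s)); first by rewrite e_sym.
  by rewrite (ltnW bs) andbT ltnW // (leq_ltn_trans _ rb) // r_max.
(* Otherwise [t] lies at or before [y], and [w], seeing [t] and [s], would see [y] between them. *)
have rt : pB r < pB t.
  rewrite ltnNge; apply: contra wy => tr.
  have ty : pB t <= pB y.
    case: (boolP (e v t)) => vt; first exact: KB_colours.
    rewrite leqNgt; apply: contra vt => yt.
    by apply: (convB vA tA vy vr); rewrite (ltnW yt).
  apply: (convB wA yB (_ : e w t) (_ : e w s)); rewrite ?(e_sym w) //.
  by rewrite ty ltnW // (leq_ltn_trans _ rs) // r_max.
rewrite (negbTE tA) rt (left_all t w) //=.
(* When [w] is past [x], either [E] already holds or [s] is adjacent to [x] and itself witnesses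
   [E]. *)
case: (leqP (pA w) (pA x)) => wx.
  by apply/orP; left; apply/existsP; exists w; rewrite tw.
apply/orP; right; case/orP: sxE => // /rs_x/(_ (ltnW wx)) sx.
by apply/existsP; exists s; rewrite sA rs e_sym sx s_near.
Qed.

(** Reversing the order of side A preserves convexity, so [x] may be assumed not to come after
    [v]. *)
Lemma kempe_component (pA : T -> nat) : convex_for e (predC A) pA ->
  exists W : pred T, [/\ W x, forall b, ~~ A b -> W b -> pB r < pB b &
    {in S :\ v &, forall s t, c s \in [:: c y; c x] -> c t \in [:: c y; c x] ->
      sq s t -> W s -> W t}].
Proof.
move=> convA; case: (leqP (pA x) (pA v)) => [|vx_pos].
  exact: kempe_component_oriented.
pose M := \max_s pA s.
have pM s : pA s <= M by apply: leq_bigmax.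
apply: (@kempe_component_oriented (fun s => M - pA s)); last by lia.
move=> b q1 q q2 bB qA b1 b2 q12.
apply: (convA b q2 q q1) => //.
by have := pM q; have := pM q1; have := pM q2; lia.
Qed.

End Kempe.

(** * Extending a colouring to the leftmost vertex *)

Variables (pA : T -> nat) (k : nat).
Hypothesis convA : convex_for e (predC A) pA.
Hypothesis vS : v \in S.
Hypothesis small_cliques : forall K : {set T}, K \subset S ->
  {in K &, forall s t, s != t -> sq s t} -> #|K| <= k.

Definition colouring (X : {set T}) (c : T -> nat) :=
  {in X, forall s, c s < k} /\ proper_on sq X c.

Let KA := [set a in S | A a & sq v a].
Let KB := [set b in S | e v b].

Lemma sq_leftmost_KA_KB s : s \in S -> sq v s -> (s \in KA) || (s \in KB).
Proof.
move=> sS vs; rewrite !inE sS vs andbT /=.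
have [->|[<- _ _]] := square_relP vs; first by rewrite orbT.
by rewrite vA.
Qed.

Lemma extend_free (c : T -> nat) (i : nat) : i < k -> colouring (S :\ v) c ->
  {in KA, forall s, c s != i} -> {in KB, forall s, c s != i} ->
  exists c', colouring S c'.
Proof.
move=> ik [c_lt c_proper] nA nB; exists (fun s => if s == v then i else c s).
have ncol s : s \in S -> sq v s -> c s != i.
  by move=> sS /(sq_leftmost_KA_KB sS)/orP[/nA|/nB].
split=> [s sS|s t sS tS st].
  by case: eqVneq => // sv; apply: c_lt; rewrite in_setD1 sv.
case: eqVneq => [sv|sv]; case: eqVneq => [tv|tv].
- by move: st; rewrite sv tv /square_rel eqxx.
- by apply/eqP; rewrite eq_sym ncol // -sv.
- by apply/eqP; rewrite ncol // square_rel_sym -tv.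
- by apply: c_proper; rewrite // in_setD1 ?sv ?tv.
Qed.

Lemma KA_clique : {in KA &, forall s t, s != t -> sq s t}.
Proof.
move=> s t; rewrite !inE => /and3P[sS sA vs] /and3P[tS tA vt] st.
by apply: (@square_rel_mid r) => //; apply: square_rel_leftmost.
Qed.

Lemma KB_clique : {in KB &, forall s t, s != t -> sq s t}.
Proof.
move=> s t; rewrite !inE => /andP[_ vs] /andP[_ vt] st.
by apply: (@square_rel_mid v); rewrite // e_sym.
Qed.

(** Adding [v] to [Q] gives a clique of [S], so [Q] has fewer than [k] vertices. *)
Lemma missing_colour_clique (c : T -> nat) (Q : {set T}) :
    Q \subset S -> v \notin Q ->
    {in Q, forall s, sq v s} -> {in Q &, forall s t, s != t -> sq s t} ->
  exists2 i, i < k & {in Q, forall s, c s != i}.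
Proof.
move=> QS vQ Qv Q_clique; apply: missing_colour.
have: #|v |: Q| <= k; last by rewrite cardsU1 vQ.
apply: small_cliques.
  by apply/subsetP=> s /setU1P[->//|/(subsetP QS)].
move=> s t /setU1P[->|sQ] /setU1P[->|tQ] st.
- by rewrite eqxx in st.
- exact: Qv.
- by rewrite square_rel_sym Qv.
- exact: Q_clique.
Qed.

Lemma KA_subset : KA \subset S :\ v.
Proof.
apply/subsetP=> s; rewrite !inE => /and3P[-> _ /andP[vs _]].
by rewrite eq_sym vs.
Qed.

Lemma KB_subset : KB \subset S :\ v.
Proof.
apply/subsetP=> s; rewrite !inE => /andP[-> vs].
by rewrite andbT; case/andP: (square_rel_edge vs); rewrite eq_sym.
Qed.

(** The invariant is that the colour of [y] is missing on [KA]; each round moves [y] left in [KB],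
    so the bound [n] drops. *)
Lemma extend_from (n : nat) (c : T -> nat) (y : T) :
  colouring (S :\ v) c -> y \in KB -> {in KA, forall s, c s != c y} ->
  pB y < n -> exists c', colouring S c'.
Proof.
elim: n c y => [|n IHn] c y // c_col yKB KA_y yn.
have [c_lt c_proper] := c_col.
have sub_KA s : s \in KA -> s \in S :\ v := subsetP KA_subset s.
have sub_KB s : s \in KB -> s \in S :\ v := subsetP KB_subset s.
have [yS vy] : y \in S /\ e v y by move: yKB; rewrite inE => /andP.
have yB : ~~ A y by rewrite -(e_bip vy).
pose Q := [set s in KA | e s y] :|: [set s in KB | pB y <= pB s].
have [||s|s t|c0 c0k c0Q] := @missing_colour_clique c Q.
- apply/subsetP=> s /setUP[]; rewrite inE => /andP[].
    by move/sub_KA/setD1P=> [].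
  by move/sub_KB/setD1P=> [].
- apply/negP=> /setUP[]; rewrite inE => /andP[].
    by move/sub_KA; rewrite setD11.
  by move/sub_KB; rewrite setD11.
- case/setUP; rewrite inE => /andP[]; first by rewrite inE => /and3P[].
  by rewrite inE => /andP[_ /square_rel_edge].
(* [a] sees [y] and, by [square_rel_leftmost], [r]; [b] lies between these two. *)
- have mix a b : a \in [set s in KA | e s y] ->
      b \in [set s in KB | pB y <= pB s] -> e a b.
    rewrite inE => /andP[aKA ay]; rewrite inE => /andP[bKB yb].
    move: aKA bKB; rewrite !inE => /and3P[aS aA va] /andP[bS vb].
    apply: (convB aA _ ay (square_rel_leftmost aS aA va)).
      by rewrite -(e_bip vb).
    by rewrite yb r_max.
  move=> /setUP[sQ|sQ] /setUP[tQ|tQ] st.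
  + by move: sQ tQ => /setIdP[sK _] /setIdP[tK _]; apply: KA_clique.
  + by apply: square_rel_edge; apply: mix.
  + by rewrite square_rel_sym; apply: square_rel_edge; apply: mix.
  + by move: sQ tQ => /setIdP[sK _] /setIdP[tK _]; apply: KB_clique.
have c0y : c y != c0 by apply: c0Q; rewrite !inE yS vy leqnn orbT.
have c0_left s : s \in KB -> c s = c0 -> pB s < pB y.
  move=> sKB cs; rewrite ltnNge; apply/negP=> ys.
  suff /c0Q: s \in Q by rewrite cs eqxx.
  by apply/setUP; right; rewrite inE sKB.
(* It suffices to clear [c0] from [KA] without touching [KB]: then either [c0] is free at [v], or a
   vertex of [KB] coloured [c0] takes over from [y]. *)
suff [c' [c'_col c'KA c'KB]] : exists c', [/\ colouring (S :\ v) c',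
    {in KA, forall s, c' s != c0} & {in KB, c' =1 c}].
  case: (boolP [exists s in KB, c s == c0]) => [/exists_inP[s sKB /eqP cs]|].
    apply: (IHn c' s) => //; first by rewrite (c'KB s sKB) cs.
    by have := c0_left s sKB cs; lia.
  move=> /exists_inPn nKB; apply: (extend_free c0k c'_col c'KA) => s sKB.
  by rewrite c'KB // nKB.
case: (boolP [exists x in KA, c x == c0]); last first.
  by move/exists_inPn => nKA; exists c; split.
case/exists_inP=> x xKA /eqP cx.
have [xS xA vx] : [/\ x \in S, A x & sq v x] by move: xKA; rewrite inE => /and3P[].
have nxy : ~~ e x y.
  apply/negP=> xy; suff /c0Q: x \in Q by rewrite cx eqxx.
  by apply/setUP; left; rewrite inE xKA.
have KA_x s : s \in KA -> c s = c0 -> s = x.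
  move=> sKA cs; apply/eqP/negP=> /negP sx.
  have := c_proper s x (sub_KA _ sKA) (sub_KA _ xKA) (KA_clique sKA xKA sx).
  by rewrite cs cx.
have KB_y s : s \in KB -> c s = c y -> s = y.
  move=> sKB cs; apply/eqP/negP=> /negP sy.
  exact: c_proper s y (sub_KB _ sKB) (sub_KB _ yKB) (KB_clique sKB yKB sy) cs.
have [||W [Wx W_right W_closed]] :=
    @kempe_component c x y c_proper xS xA vx yS vy nxy _ _ pA convA.
- move=> a aS aA va; have aKA : a \in KA by rewrite !inE aS aA.
  rewrite !inE (negbTE (KA_y a aKA)) cx => /eqP; exact: KA_x.
- move=> b bS vb; have bKB : b \in KB by rewrite !inE bS.
  by rewrite !inE cx => /orP[/eqP/(KB_y b bKB)->//|/eqP/(c0_left b bKB)/ltnW].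
(* On [KA] the swap changes only [x], since the colour of [y] is absent there; [KB] lies up to [r],
   hence outside [W]. *)
exists (kempe_swap W (c y) (c x) c); split.
- split; last exact: kempe_swap_proper square_rel_sym _ _.
  move=> s sS; rewrite /kempe_swap.
  have cyk : c y < k by apply/c_lt/sub_KB.
  by do !case: ifP => // _; rewrite ?cx //; apply: c_lt.
- move=> s sKA; rewrite /kempe_swap (negbTE (KA_y s sKA)) cx.
  case: (c s =P c0) => [/(KA_x s sKA)->|/eqP cs]; first by rewrite Wx.
  by rewrite if_same.
- move=> s; rewrite inE => /andP[sS vs]; rewrite /kempe_swap.
  case: (boolP (W s)) => // /W_right.
  by rewrite -(e_bip vs) ltnNge r_max // => /(_ vA).
Qed.

Lemma extend_leftmost (c : T -> nat) : colouring (S :\ v) c ->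
  exists c', colouring S c'.
Proof.
move=> c_col.
have [||s||i ik iKA] := @missing_colour_clique c KA.
- exact: subset_trans KA_subset (subD1set _ _).
- by apply: contraTN isT => /(subsetP KA_subset); rewrite setD11.
- by rewrite inE => /and3P[].
- exact: KA_clique.
case: (boolP [exists s in KB, c s == i]) => [/exists_inP[s sKB /eqP cs]|].
  by apply: (extend_from c_col sKB) (ltnSn _) => t tKA; rewrite cs iKA.
by move/exists_inPn; apply: extend_free.
Qed.

End LeftmostVertex.

(** * Induction on the set of vertices to be coloured *)

(** Only [S] shrinks while [e] stays whole: common neighbours outside [S] still count, so what is
    coloured is an induced subgraph of the square. *)
Lemma biconvex_square_colouring (T : finType) (e : rel T) (A : pred T)
    (pA pB : T -> nat) (k : nat) (S : {set T}) :
  symmetric e -> (forall x y, e x y -> A x = ~~ A y) ->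
  convex_for e A pB -> convex_for e (predC A) pA ->
  (forall K : {set T}, K \subset S ->
    {in K &, forall s t, s != t -> square_rel e s t} -> #|K| <= k) ->
  exists c, colouring e k S c.
Proof.
move=> e_sym.
have [n] := ubnP #|S|; elim: n S A pA pB => // n IHn S A pA pB Sn.
wlog [u uS uA] : A pA pB / exists2 u, u \in S & A u.
  move=> IH; case: (set_0Vmem S) => [->|[u uS]].
    by move=> *; exists (fun=> 0); split=> s; rewrite inE.
  case: (boolP (A u)) => [uA|uA]; first by apply: (IH A); exists u.
  move=> e_bip convB convA cliques.
  apply: (IH (predC A) pB pA) => //; first by exists u.
    by move=> x y /e_bip /= ->.
  by move=> x y1 y y2; rewrite /= !negbK => xA; apply: convB.
move=> e_bip convB convA cliques.
pose right_end a := \max_(b | e a b) pB b.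
have [v /andP[vS vA] v_min] :=
  @arg_minnP _ u [pred a | (a \in S) && A a] right_end
    (introT andP (conj uS uA)).
have [c [c_lt c_proper]] : exists c, colouring e k (S :\ v) c.
  apply: (IHn (S :\ v) A pA pB) => //; first by rewrite (cardsD1 v S) vS in Sn; lia.
  by move=> K KS; apply: cliques; apply: subset_trans KS (subD1set _ _).
have right_endP a b : e a b -> pB b <= right_end a.
  by move=> ab; apply: (@leq_bigmax_cond _ (e a) pB).
have right_end_attained a b : e a b -> exists2 b', e a b' & right_end a = pB b'.
  move=> ab; have [|b' b'1 b'2] := @eq_bigmax_cond _ (e a) pB; last by exists b'.
  by apply/card_gt0P; exists b.
case: (boolP [exists b, e v b]) => [/existsP[b vb]|/existsPn v_isol].
  have [r vr vr_end] := right_end_attained v b vb.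
  apply: (extend_leftmost e_sym e_bip convB vA vr _ _ convA vS cliques
    (conj c_lt c_proper)).
    by move=> b' /right_endP; rewrite vr_end.
  move=> a b' aS aA /right_end_attained[b'' ab'' eb'']; exists b'' => //.
  by rewrite -eb'' -vr_end; apply: v_min; rewrite /= aS.
have v_alone s : square_rel e v s = false.
  apply/negP=> /andP[_]; rewrite (negbTE (v_isol _)) => /existsP[z].
  by rewrite (negbTE (v_isol _)).
(* Colour 0 is available because the clique [[set v]] forces [k] to be positive. *)
exists (fun s => if s == v then 0 else c s); split=> [s sS|s t sS tS].
  case: eqVneq => sv; last by apply: c_lt; rewrite in_setD1 sv.
  have := cliques [set v]; rewrite cards1; apply; first by rewrite sub1set.
  by move=> ? ? /set1P-> /set1P->; rewrite eqxx.
case: eqVneq => [->|sv]; first by rewrite v_alone.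
case: eqVneq => [->|tv]; first by rewrite (square_rel_sym e_sym) v_alone.
by apply: c_proper; rewrite in_setD1 ?sv ?tv.
Qed.

(** * From distances and linear orders to relations and positions *)

Lemma square_edgeE (G : sgraph) : @square_edge G =2 square_rel edge.
Proof.
move=> x y; rewrite /square_edge /square_rel.
case: (eqVneq x y) => //= xy; apply/idP/idP.
  case/existsP=> [[[|[|[|k]]] k_lt]] //= /existsP[p /and3P[]].
  - by rewrite (tuple0 p) /= (negbTE xy).
  - by case/tupleP: p => z p; rewrite (tuple0 p) /= andbT => xz _ /eqP<-; rewrite xz.
  case/tupleP: p => z p; case/tupleP: p => t p; rewrite (tuple0 p) /= andbT.
  by move=> xzt _ /eqP<-; apply/orP; right; apply/existsP; exists z.
case/orP=> [xy_edge|/existsP[z /andP[xz zy]]]; apply/existsP.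
  exists (Ordinal (isT : 1 < 3)); apply/existsP; exists [tuple y].
  by rewrite /path_from_to /= xy_edge inE xy eqxx.
exists (Ordinal (isT : 2 < 3)); apply/existsP; exists [tuple z; y].
rewrite /path_from_to /= xz zy !inE (negbTE xy) eqxx !andbT /= orbF.
by apply/andP; split; [apply: contraTneq xz | apply: contraTneq zy] => ->;
  rewrite edge_irr.
Qed.

Definition rank_in (T : finType) (X : {set T}) (le : rel T) (x : T) : nat :=
  #|[set y in X | le y x]|.

(** If [le y x], the down-set of [y] lies in that of [x]; when the ranks compare the other way the
    two coincide, and [x] belongs to both. *)
Lemma leq_rank_in (T : finType) (X : {set T}) (le : rel T) :
  linear_order_on X le ->
  {in X &, forall x y, (rank_in X le x <= rank_in X le y) = le x y}.
Proof.
case=> le_refl _ le_trans le_total.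
have sub x y : x \in X -> y \in X -> le x y ->
    [set z in X | le z x] \subset [set z in X | le z y].
  move=> xX yX xy; apply/subsetP=> z; rewrite !inE => /andP[zX zx].
  by rewrite zX (le_trans x).
move=> x y xX yX; apply/idP/idP => [xy|]; last by move/sub/subset_leq_card; apply.
have /orP[//|yx] := le_total x y xX yX.
have /eqP sets_eq : [set z in X | le z y] == [set z in X | le z x].
  by rewrite eqEcard sub.
have: x \in [set z in X | le z x] by rewrite inE xX le_refl.
by rewrite -sets_eq inE => /andP[].
Qed.

Lemma consecutive_convex (G : sgraph) (A B : {set G}) (leB : rel G) :
  bipartition A B -> linear_order_on B leB ->
  {in A, forall a, consecutive_in B leB (neighbours a)} ->
  convex_for edge (mem A) (rank_in B leB).
Proof.
move=> [AB_T AB_disj AB_edge] leB_order consec x y1 y y2 /= xA yA xy1 xy2.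
have in_B z : edge x z -> z \in B.
  by case/AB_edge/orP=> /andP[] //; rewrite (disjointFr AB_disj xA).
have yB : y \in B.
  by have := in_setT y; rewrite -AB_T inE (negbTE yA).
have [y1B y2B] := (in_B _ xy1, in_B _ xy2).
rewrite !leq_rank_in // => /andP[y1y yy2].
have := consec x xA y1 y y2 y1B yB y2B; rewrite !inE.
exact.
Qed.

Lemma square_colouring (G : sgraph) (k : nat) (S : {set G}) :
  biconvex_bipartite G ->
  (forall K : {set G}, K \subset S ->
    {in K &, forall s t, s != t -> square_rel edge s t} -> #|K| <= k) ->
  exists c, colouring edge k S c.
Proof.
case=> A [B [bipAB [leA [leB [leA_order leB_order consecA consecB]]]]].
have [AB_T AB_disj AB_edge] := bipAB.
have AC : A = ~: B.
  apply/setP=> x; rewrite inE; have := in_setT x; rewrite -AB_T inE.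
  case: (boolP (x \in A)) => [/(disjointFr AB_disj)->|_ /= ->] //.
apply: (biconvex_square_colouring (A := mem A) (pA := rank_in A leA)
  (pB := rank_in B leB)).
- exact: edge_sym.
- by move=> x y /AB_edge /=; rewrite AC !inE; case: (x \in B); case: (y \in B).
- exact: consecutive_convex.
have bipBA : bipartition B A.
  split; rewrite 1?setUC 1?disjoint_sym // => x y /AB_edge.
  by rewrite orbC.
move=> x y1 y y2 /= xA; rewrite negbK => yA; apply: (consecutive_convex bipBA) => //=.
  by move: xA; rewrite AC inE negbK.
by move: yA; rewrite AC inE.
Qed.

(** * Cliques, colourings and perfection *)

Lemma clique_leq_colorable (G : sgraph) (K : {set G}) (k : nat) :
  clique K -> colorable G k -> #|K| <= k.
Proof.
move=> /forall_inP K_clique /existsP[c /forallP c_proper].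
rewrite -[k]card_ord -(card_in_imset (f := c)); first exact: max_card.
move=> x y xK yK cxy; apply/eqP; apply/negPn/negP=> xy.
have /forall_inP/(_ y yK) := K_clique x xK; rewrite xy /= => exy.
by have /forallP/(_ y) := c_proper x; rewrite exy cxy eqxx.
Qed.

Lemma colouring_colorable (G : sgraph) (S : {set G}) (k : nat) (c : G -> nat) :
  {in S, forall s, c s < k} -> proper_on edge S c -> colorable (induced S) k.
Proof.
move=> c_lt c_proper; apply/existsP.
exists [ffun x : induced S => Ordinal (c_lt (val x) (valP x))].
apply/forallP=> x; apply/forallP=> y; apply/implyP=> xy; rewrite !ffunE.
apply/eqP=> -[]; exact: c_proper (valP x) (valP y) xy.
Qed.

Lemma biconvex_square_perfect (G : sgraph) :
  biconvex_bipartite G -> perfect (square G).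
Proof.
move=> hG S; rewrite /chromatic_number; case: ex_minnP => k k_col k_min.
apply/eqP; rewrite eqn_leq; apply/andP; split; last first.
  by apply/bigmax_leqP=> K /clique_leq_colorable; apply.
apply: k_min.
have [K KS K_clique|c [c_lt c_proper]] :=
    @square_colouring G (clique_number (induced S)) S hG.
  (* [clique_number] ranges over sets of the subtype, so [K] is pulled back to it. *)
  pose K' : {set induced S} := [set x | val x \in K].
  have -> : K = val @: K'.
    apply/setP=> x; apply/idP/imsetP => [xK|[y]]; last by rewrite inE => ? ->.
    by exists (Sub x (subsetP KS x xK)); rewrite ?inE SubK.
  rewrite card_imset; last exact: val_inj.
  apply: (leq_bigmax_cond (F := fun K : {set induced S} => #|K|)).
  apply/forall_inP=> x; rewrite inE => xK; apply/forall_inP=> y; rewrite inE => yK.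
  by apply/implyP=> xy; rewrite /= /induced_edge /= square_edgeE; apply: K_clique.
apply: (colouring_colorable (G := square G) c_lt) => s t sS tS st.
by apply: c_proper => //; rewrite -square_edgeE.
Qed.

(** * The five-cycle *)

Lemma C5_clique (K : {set 'I_5}) :
  {in K &, forall i j, i != j -> cycle_edge i j} -> #|K| <= 2.
Proof.
move=> K_clique; rewrite leqNgt; apply/negP=> /card_gt2P[i [j [l [[iK jK lK] []]]]].
move=> /(K_clique i j iK jK) + /(K_clique j l jK lK) + /(K_clique l i lK iK).
by case: i j l {iK jK lK} => [[|[|[|[|[|i]]]]] //= ?] [[|[|[|[|[|j]]]]] //= ?]
  [[|[|[|[|[|l]]]]] //= ?].
Qed.

Theorem theorem8 (G : sgraph) (hG : biconvex_bipartite G) :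
  C5_free (square G) /\ perfect (square G).
Proof.
split; last exact: biconvex_square_perfect.
case=> f [f_inj f_edge].
have f_sq i j : square_rel (@edge G) (f i) (f j) = cycle_edge i j.
  by rewrite -f_edge -square_edgeE.
have [K KS K_clique|c [c_lt c_proper]] := @square_colouring G 2 (f @: setT) hG.
  have -> : K = f @: (f @^-1: K).
    apply/setP=> x; apply/idP/imsetP => [xK|[i]]; last by rewrite inE => ? ->.
    have /imsetP[i _ xi] := subsetP KS x xK.
    by exists i; rewrite ?inE -?xi.
  rewrite card_imset //; apply: C5_clique => i j; rewrite !inE => iK jK ij.
  by rewrite -f_sq; apply: K_clique; rewrite ?(inj_eq f_inj).
have cf_lt i : c (f i) < 2 by apply/c_lt/imset_f.
have cf_proper i j : cycle_edge i j -> c (f i) <> c (f j).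
  by rewrite -f_sq; apply: c_proper; apply: imset_f.
pose o i : 'I_5 := inord i.
have step i : i < 5 -> c (f (o i)) <> c (f (o (i.+1 %% 5))).
  by move=> i5; apply: cf_proper; rewrite /cycle_edge !inordK ?eqxx // ltn_pmod.
(* The colours 0 and 1 would have to alternate around an odd cycle. *)
have := (step 0 isT, step 1 isT, step 2 isT, step 3 isT, step 4 isT).
rewrite (modnn 5) !modn_small //.
have := (cf_lt (o 0), cf_lt (o 1), cf_lt (o 2), cf_lt (o 3), cf_lt (o 4)).
by case=> [[[[? ?] ?] ?] ?] [[[[? ?] ?] ?] ?]; lia.
Qed.
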